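(* Let $n\ge2$ and $x,y\in\mathbb{R}^n$, regarded as data points $(x_i,y_i)$, $1\le i\le n$, in the plane. (a) In the $Y$ method (when $\operatorname{var}(x)\ne0$) the regression line can be written $(y-\overline{y})\operatorname{var}(x)=(x-\overline{x})\operatorname{cov}(x,y)$; in the $X$ method (when $\operatorname{var}(y)\ne 0$) it can be written $(x-\overline{x})\operatorname{var}(y)=(y-\overline{y})\operatorname{cov}(x,y)$; in the $D$ method it can be written $(x-\overline{x})\sin\theta=(y-\overline{y})\cos\theta$, where $\theta$ is a minimizing angle. (b) The point $(\overline{x},\overline{y})$ is on the regression line of each method; hence the three lines intersect there. (c) $\operatorname{var}(x)\operatorname{var}(y)\ge\operatorname{cov}(x,y)^2$, with equality if and only if all the points $(x_i,y_i)$ lie on the same line. (d) If they exist, the slopes of the regression lines in the $Y$, $X$ and $D$ methods have the same sign. (e) Suppose $\operatorname{cov}(x,y)\neq0$. Let $m=\operatorname{cov}(x,y)/\operatorname{var}(x)$ be the slope of the regression line in the $Y$ method and $m_X=\operatorname{var}(y)/\operatorname{cov}(x,y)$ the slope in the $X$ method. Then $|m|\le\sqrt{\operatorname{var}(y)/\operatorname{var}(x)}\le|m_X|$, with equality (in each of the two inequalities) if and only if all the points $(x_i,y_i)$ lie on the same line. (f) Suppose $\operatorname{cov}(x,y)\ne0$, let $m,m_X$ be as in (e), and let $\tan\theta$ be the slope of the regression line in the $D$ method. The inequality $|m|\le|\tan\theta|\le|m_X|$ holds if $\operatorname{var}(x)\ge\operatorname{var}(y)$. It also holds if $\operatorname{var}(x)<\operatorname{var}(y)$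 and $2\operatorname{cov}(x,y)^2\ge\operatorname{var}(x)\,|\operatorname{var}(x)-\operatorname{var}(y)|$.
   Context: For $x,y\in\mathbb{R}^n$, $n\ge2$: $\overline{x}=\frac1n\sum x_i$, $\overline{xy}=\frac1n\sum x_iy_i$, $\operatorname{cov}(x,y)=\overline{xy}-\overline{x}\,\overline{y}$, $\operatorname{var}(x)=\operatorname{cov}(x,x)$. Regression lines. $Y$ method (requires $\operatorname{var}(x)\ne0$): the line $y=mx+b$ where $(m,b)\in\mathbb{R}^2$ is the unique minimizer of $\frac1n\sum_{i=1}^n(mx_i+b-y_i)^2$. $X$ method (requires $\operatorname{var}(y)\neq0$): the line $x=\mu y+\beta$ where $(\mu,\beta)\in\mathbb{R}^2$ is the unique minimizer of $\frac1n\sum_{i=1}^n(\mu y_i+\beta-x_i)^2$; its slope is $m_X=1/\mu$, which exists when $\mu\ne0$, i.e. when $\operatorname{cov}(x,y)\ne0$. $D$ method: a line $x\sin\theta-y\cos\theta=c$ where $(\theta,c)$, $-\pi/2<\theta\le\pi/2$, $c\in\mathbb{R}$, minimizes $\frac1n\sum_{i=1}^n(x_i\sin\theta-y_i\cos\theta-c)^2$; the minimizer is unique unless $\operatorname{var}(x)=\operatorname{var}(y)$ and $\operatorname{cov}(x,y)=0$. The slope of the $D$ regression line is $\tan\theta$; it is said to exist when the minimizer is unique and $\theta\neq\pi/2$. ''Same sign'' means that the slopes that exist are all positive, all negative, or all zero. *)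

(* Defs.v *)
From mathcomp Require Import all_boot all_order all_algebra.
From mathcomp Require Import all_classical all_reals all_analysis.

Set Implicit Arguments.
Unset Strict Implicit.
Unset Printing Implicit Defensive.

Import Order.TTheory GRing.Theory Num.Theory.
Import numFieldNormedType.Exports.

Local Open Scope classical_set_scope.
Local Open Scope ring_scope.

Definition mean (R : realType) (n : nat) (f : 'I_n -> R) : R :=
  n%:R^-1 * \sum_(i < n) f i.

Definition cov (R : realType) (n : nat) (x y : 'rV[R]_n) : R :=
  mean (fun i => x 0 i * y 0 i) - mean (x 0) * mean (y 0).

Definition var (R : realType) (n : nat) (x : 'rV[R]_n) : R := cov x x.

Definition minimizer (R : realType) (T : Type) (D : set T) (f : T -> R)
    (t : T) : Prop :=
  D t /\ forall s, D s -> f t <= f s.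

Definition unique_minimizer (R : realType) (T : Type) (D : set T) (f : T -> R)
    (t : T) : Prop :=
  minimizer D f t /\ forall s, minimizer D f s -> s = t.

Definition Y_loss (R : realType) (n : nat) (x y : 'rV[R]_n) (p : R * R) : R :=
  mean (fun i => (p.1 * x 0 i + p.2 - y 0 i) ^+ 2).

Definition X_loss (R : realType) (n : nat) (x y : 'rV[R]_n) (p : R * R) : R :=
  mean (fun i => (p.1 * y 0 i + p.2 - x 0 i) ^+ 2).

(* Mean squared distance to the line with unit normal (sin t, - cos t);
   here p = (t, c). *)
Definition D_loss (R : realType) (n : nat) (x y : 'rV[R]_n) (p : R * R) : R :=
  mean (fun i => (x 0 i * sin p.1 - y 0 i * cos p.1 - p.2) ^+ 2).

Definition D_domain (R : realType) : set (R * R) :=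
  [set p : R * R | - (pi / 2) < p.1 <= pi / 2].

Definition Y_fit (R : realType) (n : nat) (x y : 'rV[R]_n) (m b : R) : Prop :=
  var x != 0 /\ unique_minimizer setT (Y_loss x y) (m, b).

Definition X_fit (R : realType) (n : nat) (x y : 'rV[R]_n)
    (mu beta : R) : Prop :=
  var y != 0 /\ unique_minimizer setT (X_loss x y) (mu, beta).

(* Not necessarily unique: every minimizer gives a D regression line. *)
Definition D_fit (R : realType) (n : nat) (x y : 'rV[R]_n)
    (theta c : R) : Prop :=
  minimizer (@D_domain R) (D_loss x y) (theta, c).

Definition D_line_of (R : realType) (theta c : R) : set (R * R) :=
  [set p : R * R | p.1 * sin theta - p.2 * cos theta = c].

Definition is_Y_line (R : realType) (n : nat) (x y : 'rV[R]_n)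
    (L : set (R * R)) : Prop :=
  exists m b, Y_fit x y m b /\ L = [set p : R * R | p.2 = m * p.1 + b].

Definition is_X_line (R : realType) (n : nat) (x y : 'rV[R]_n)
    (L : set (R * R)) : Prop :=
  exists mu beta,
    X_fit x y mu beta /\ L = [set p : R * R | p.1 = mu * p.2 + beta].

Definition is_D_line (R : realType) (n : nat) (x y : 'rV[R]_n)
    (L : set (R * R)) : Prop :=
  exists theta c, D_fit x y theta c /\ L = D_line_of theta c.

(* [Y_slope x y s] reads: the slope in the Y method exists and equals s;
   likewise for X and D. *)
Definition Y_slope (R : realType) (n : nat) (x y : 'rV[R]_n) (s : R) : Prop :=
  exists b, Y_fit x y s b.

Definition X_slope (R : realType) (n : nat) (x y : 'rV[R]_n) (s : R) : Prop :=
  exists mu beta, [/\ X_fit x y mu beta, mu != 0 & s = 1 / mu].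

Definition D_slope (R : realType) (n : nat) (x y : 'rV[R]_n) (s : R) : Prop :=
  exists theta c,
    [/\ unique_minimizer (@D_domain R) (D_loss x y) (theta, c),
        theta != pi / 2 & s = tan theta].

Definition regression_slopes (R : realType) (n : nat) (x y : 'rV[R]_n) :
    set R :=
  [set s | [\/ Y_slope x y s, X_slope x y s | D_slope x y s]].

Definition same_sign (R : realType) (S : set R) : Prop :=
  [\/ forall s, S s -> 0 < s,
      forall s, S s -> s < 0 |
      forall s, S s -> s = 0].

Definition is_line (R : realType) (L : set (R * R)) : Prop :=
  exists a b c : R,
    (a != 0 \/ b != 0) /\ L = [set p : R * R | a * p.1 + b * p.2 = c].

Definition collinear (R : realType) (n : nat) (x y : 'rV[R]_n) : Prop :=
  exists L : set (R * R), is_line L /\ forall i, L (x 0 i, y 0 i).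

(* Main.v *)
Require Import Defs.
From mathcomp Require Import all_boot all_order all_algebra.
From mathcomp Require Import all_classical all_reals all_analysis.
From mathcomp Require Import ring lra.

Import Order.TTheory GRing.Theory Num.Theory.
Import numFieldNormedType.Exports.

Local Open Scope classical_set_scope.
Local Open Scope ring_scope.

(** Write A = var x, B = var y, C = cov x y.  Expanding a square gives
      mean ((a x + b y + c)^2)
        = a^2 A + 2 a b C + b^2 B + (a xbar + b ybar + c)^2,
    and [mean_affine_sq], which says this, reduces every claim to the
    quadratic form with matrix [[A, C], [C, B]].  The last square vanishes for
    exactly one c, the one that puts the line through (xbar, ybar); this is
    why all three regression lines pass through the mean point.

    The form is positive semidefinite, being a mean of squares, hence
    C^2 <= A B, and it is degenerate exactly when some nontrivial a x + b y is
    constant on the data.  In the Y method (a, b) = (m, -1), and completing the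
    square in m gives the slope C / A; the X method is the Y method with the
    coordinates exchanged.

    In the D method (a, b) = (sin t, - cos t) is a unit vector, so the minimum
    is the least eigenvalue l of the form.  When C != 0 we have 0 <= l < A,
    l < B and (A - l) (B - l) = C^2, and for a line through the mean point the
    loss exceeds l by ((A - l) sin t - C cos t)^2 / (A - l).  So the minimizing
    angle is unique, with slope C / (A - l) = (B - l) / C.  Comparing with C / A
    and B / C, which are the same expressions with l replaced by 0, gives the
    sign statement and both bounds on the D slope.  When C = 0 the reflection
    t |-> - t preserves the minimum, so a unique non-vertical D line is
    horizontal. *)

(** * The quadratic form of the data *)

Lemma mean_sq_ge0 {R : realType} {n : nat} (f : 'I_n -> R) :
  0 <= mean (fun i => f i ^+ 2).
Proof.
by rewrite /mean mulr_ge0 ?invr_ge0 ?ler0n ?sumr_ge0 // => i _; exact: sqr_ge0.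
Qed.

Lemma mean_sq_eq0 {R : realType} {n : nat} (f : 'I_n -> R) :
  mean (fun i => f i ^+ 2) = 0 <-> forall i, f i = 0.
Proof.
split=> [/eqP + i|f0]; last first.
  by rewrite /mean big1 ?mulr0 // => i _; rewrite f0 expr0n.
rewrite /mean mulf_eq0 invr_eq0 pnatr_eq0 => /orP[/eqP n0|].
  by have := leq_ltn_trans (leq0n i) (ltn_ord i); rewrite n0.
rewrite psumr_eq0 => [/allP/(_ i (mem_index_enum _))|j _]; last exact: sqr_ge0.
by rewrite sqrf_eq0 => /eqP.
Qed.

Lemma covC {R : realType} {n : nat} (x y : 'rV[R]_n) : cov x y = cov y x.
Proof.
rewrite /cov mulrC; congr (_ - _); rewrite /mean.
by congr (_ * _); apply: eq_bigr => i _; rewrite mulrC.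
Qed.

(** The mean of a square is the variance plus the square of the mean, and the
    variance of a x + b y + c is a quadratic form in (a, b). *)
Lemma mean_affine_sq {R : realType} {n : nat} (x y : 'rV[R]_n) (a b c : R) :
  (0 < n)%N ->
  mean (fun i => (a * x 0 i + b * y 0 i + c) ^+ 2) =
  a ^+ 2 * var x + 2 * a * b * cov x y + b ^+ 2 * var y +
  (a * mean (x 0) + b * mean (y 0) + c) ^+ 2.
Proof.
move=> n_gt0; have n_neq0 : n%:R != 0 :> R by rewrite pnatr_eq0 -lt0n.
rewrite /var /cov /mean.
rewrite (eq_bigr (fun i => a ^+ 2 * (x 0 i * x 0 i)
  + 2 * a * b * (x 0 i * y 0 i) + b ^+ 2 * (y 0 i * y 0 i)
  + 2 * a * c * x 0 i + 2 * b * c * y 0 i + c ^+ 2)); last by move=> i _; ring.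
rewrite !big_split /= -!mulr_sumr sumr_const card_ord -mulr_natr.
by field.
Qed.

Lemma var_ge0 {R : realType} {n : nat} (x : 'rV[R]_n) : (0 < n)%N -> 0 <= var x.
Proof.
move=> n_gt0.
have := mean_sq_ge0 (fun i => 1 * x 0 i + 0 * x 0 i + - mean (x 0)).
by rewrite mean_affine_sq //; nra.
Qed.

(** The variances of cov x y * x - var x * y and of
    (var y + 1) * x - cov x y * y are nonnegative; the first gives the bound
    when var x > 0, the second forces cov x y = 0 when var x = 0. *)
Lemma cov_sq_le {R : realType} {n : nat} (x y : 'rV[R]_n) :
  (0 < n)%N -> cov x y ^+ 2 <= var x * var y.
Proof.
move=> n_gt0.
have form_ge0 a b : 0 <= a ^+ 2 * var x + 2 * a * b * cov x y + b ^+ 2 * var y.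
  have := mean_sq_ge0 (fun i => a * x 0 i + b * y 0 i
     + - (a * mean (x 0) + b * mean (y 0))).
  by rewrite mean_affine_sq // subrr expr0n addr0.
have := var_ge0 x n_gt0; have := var_ge0 y n_gt0.
set A := var x in form_ge0 *; set B := var y in form_ge0 *.
set C := cov x y in form_ge0 *.
move=> B_ge0; rewrite le_eqVlt => /orP[/eqP A0|A_gt0].
  rewrite -A0 mul0r; have := form_ge0 (- (B + 1)) C; rewrite -A0 mulr0 add0r.
  have -> : 2 * - (B + 1) * C * C + C ^+ 2 * B = - ((B + 2) * C ^+ 2) by ring.
  by rewrite oppr_ge0 pmulr_rle0 //; lra.
have := form_ge0 (- C) A.
have -> : (- C) ^+ 2 * A + 2 * - C * A * C + A ^+ 2 * B = A * (A * B - C ^+ 2).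
  by ring.
by rewrite pmulr_rge0 // subr_ge0.
Qed.

(** The data are collinear when a nontrivial a x + b y is constant on them,
    that is, when the form has a nontrivial zero; being semidefinite, it is then
    degenerate.  Conversely (1, 0) is a zero of a degenerate form if var x = 0,
    and (- cov x y, var x) is one in any case. *)
Lemma eq_cov_sq_collinear {R : realType} {n : nat} (x y : 'rV[R]_n) :
  (0 < n)%N -> var x * var y = cov x y ^+ 2 <-> collinear x y.
Proof.
move=> n_gt0; split=> [eqABC|].
  have [A0|A_neq0] := eqVneq (var x) 0.
    exists [set p | 1 * p.1 + 0 * p.2 = mean (x 0)]; split.
      by exists 1, 0, (mean (x 0)); split=> //; left; exact: oner_neq0.
    move=> i /=; apply/eqP; rewrite -subr_eq0; apply/eqP; move: i.
    by apply/mean_sq_eq0; rewrite mean_affine_sq // A0; ring.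
  exists [set p | - cov x y * p.1 + var x * p.2
            = - cov x y * mean (x 0) + var x * mean (y 0)]; split.
    exists (- cov x y), (var x), (- cov x y * mean (x 0) + var x * mean (y 0)).
    by split=> //; right.
  move=> i /=; apply/eqP; rewrite -subr_eq0; apply/eqP; move: i.
  apply/mean_sq_eq0; rewrite mean_affine_sq // subrr.
  by transitivity (var x * (var x * var y - cov x y ^+ 2));
    [ring | rewrite eqABC subrr mulr0].
case=> L [[a [b [c [ab_neq0 ->]]]] /= onL].
have /mean_sq_eq0 : forall i, a * x 0 i + b * y 0 i + - c = 0.
  by move=> i; rewrite onL subrr.
rewrite mean_affine_sq //.
have := cov_sq_le x y n_gt0; have := var_ge0 x n_gt0; have := var_ge0 y n_gt0.
set A := var x; set B := var y; set C := cov x y => B_ge0 A_ge0 CAB sum0.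
set Q := a ^+ 2 * A + 2 * a * b * C + b ^+ 2 * B.
have Q_le0 : Q <= 0 by rewrite /Q -sum0 lerDl sqr_ge0.
(* As Q <= 0 the nonnegative terms on the right of AQ and BQ all vanish, and
   b or a is nonzero. *)
have AQ : A * Q = (a * A + b * C) ^+ 2 + b ^+ 2 * (A * B - C ^+ 2).
  by rewrite /Q; ring.
have BQ : B * Q = (b * B + a * C) ^+ 2 + a ^+ 2 * (A * B - C ^+ 2).
  by rewrite /Q; ring.
have AQ_le0 : A * Q <= 0 by rewrite mulr_ge0_le0.
have BQ_le0 : B * Q <= 0 by rewrite mulr_ge0_le0.
have := sqr_ge0 (a * A + b * C); have := sqr_ge0 (b * B + a * C) => sq2 sq1.
have disc_le0 k : 0 < k -> k * (A * B - C ^+ 2) <= 0 -> A * B = C ^+ 2.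
  by move=> k_gt0; rewrite pmulr_rle0 // => disc; lra.
case: ab_neq0 => neq0.
  by apply: (disc_le0 (a ^+ 2)); rewrite ?exprn_even_gt0 //; lra.
by apply: (disc_le0 (b ^+ 2)); rewrite ?exprn_even_gt0 //; lra.
Qed.

(** * The Y and X methods *)

(** Completing the square in m. *)
Lemma Y_loss_eq {R : realType} {n : nat} (x y : 'rV[R]_n) (m b : R) :
  (0 < n)%N -> var x != 0 ->
  Y_loss x y (m, b) = var x * (m - cov x y / var x) ^+ 2
    + (m * mean (x 0) + b - mean (y 0)) ^+ 2
    + (var y - cov x y ^+ 2 / var x).
Proof.
move=> n_gt0 A_neq0.
transitivity (mean (fun i => (m * x 0 i + -1 * y 0 i + b) ^+ 2)).
  by rewrite /Y_loss /mean; congr (_ * _); apply: eq_bigr => i _ /=; ring.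
by rewrite mean_affine_sq //; field.
Qed.

Lemma Y_fitP {R : realType} {n : nat} (x y : 'rV[R]_n) (m b : R) :
  (0 < n)%N -> var x != 0 ->
  Y_fit x y m b <->
  m = cov x y / var x /\ b = mean (y 0) - cov x y / var x * mean (x 0).
Proof.
move=> n_gt0 A_neq0; have A_gt0 : 0 < var x by rewrite lt_def A_neq0 var_ge0.
set m0 := cov x y / var x; set b0 := mean (y 0) - m0 * mean (x 0).
have min0 : minimizer setT (Y_loss x y) (m0, b0).
  split=> // -[m' b'] _; rewrite !Y_loss_eq //.
  have -> : m0 * mean (x 0) + b0 - mean (y 0) = 0 by rewrite /b0; ring.
  rewrite -/m0 subrr expr0n mulr0 addr0 add0r lerDr.
  by rewrite addr_ge0 ?sqr_ge0 // mulr_ge0 ?sqr_ge0 ?ltW.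
have uniq0 s : minimizer setT (Y_loss x y) s -> s = (m0, b0).
  case: s => m' b' [_ /(_ (m0, b0) I)]; rewrite !Y_loss_eq //.
  have -> : m0 * mean (x 0) + b0 - mean (y 0) = 0 by rewrite /b0; ring.
  rewrite -/m0 subrr expr0n mulr0 addr0 add0r gerDr => le0.
  have sq1 : 0 <= var x * (m' - m0) ^+ 2 by rewrite mulr_ge0 ?sqr_ge0 ?ltW.
  have sq2 := sqr_ge0 (m' * mean (x 0) + b' - mean (y 0)).
  have /eqP : var x * (m' - m0) ^+ 2 = 0 by lra.
  rewrite mulf_eq0 (negPf A_neq0) sqrf_eq0 subr_eq0 => /eqP em.
  have /eqP : (m' * mean (x 0) + b' - mean (y 0)) ^+ 2 = 0 by lra.
  by rewrite sqrf_eq0 em => /eqP eb; congr pair; rewrite /b0; lra.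
split=> [[_ [/uniq0 [-> ->]]] //|[-> ->]].
by split=> //; split.
Qed.

Lemma Y_line_eq {R : realType} {n : nat} (x y : 'rV[R]_n) (m b : R) :
  (0 < n)%N -> Y_fit x y m b ->
  [set p : R * R | p.2 = m * p.1 + b] =
  [set p | (p.2 - mean (y 0)) * var x = (p.1 - mean (x 0)) * cov x y].
Proof.
move=> n_gt0 fit; have A_neq0 := fit.1.
have [-> ->] := (Y_fitP _ _ _ _ n_gt0 A_neq0).1 fit.
apply/seteqP; split=> -[u v] /= => [->|e]; first by field.
have := canRL (mulfK A_neq0) e; lra.
Qed.

(** X_fit x y is convertible to Y_fit y x, so this is the transpose of
    [Y_line_eq]. *)
Lemma X_line_eq {R : realType} {n : nat} (x y : 'rV[R]_n) (mu beta : R) :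
  (0 < n)%N -> X_fit x y mu beta ->
  [set p : R * R | p.1 = mu * p.2 + beta] =
  [set p | (p.1 - mean (x 0)) * var y = (p.2 - mean (y 0)) * cov x y].
Proof.
move=> n_gt0 fit; have := Y_line_eq y x _ _ n_gt0 fit; rewrite covC => e.
by apply/funext => -[u v]; exact: (congr1 (fun S : set (R * R) => S (v, u)) e).
Qed.

(** * The D method *)

Lemma D_loss_eq {R : realType} {n : nat} (x y : 'rV[R]_n) (t c : R) :
  (0 < n)%N ->
  D_loss x y (t, c) =
    sin t ^+ 2 * var x - 2 * sin t * cos t * cov x y + cos t ^+ 2 * var y
    + (mean (x 0) * sin t - mean (y 0) * cos t - c) ^+ 2.
Proof.
move=> n_gt0.
transitivity (mean (fun i => (sin t * x 0 i + - cos t * y 0 i + - c) ^+ 2)).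
  by rewrite /D_loss /mean; congr (_ * _); apply: eq_bigr => i _ /=; ring.
by rewrite mean_affine_sq //; ring.
Qed.

Lemma D_fit_intercept {R : realType} {n : nat} (x y : 'rV[R]_n) (t c : R) :
  (0 < n)%N -> D_fit x y t c -> c = mean (x 0) * sin t - mean (y 0) * cos t.
Proof.
move=> n_gt0 [/= tD /(_ (t, mean (x 0) * sin t - mean (y 0) * cos t) tD)].
rewrite !D_loss_eq // lerD2l subrr expr0n /= => sq_le0.
have /eqP := le_anti (introT andP (conj sq_le0 (sqr_ge0 _))).
by rewrite sqrf_eq0 subr_eq0 => /eqP.
Qed.

(** The root l = (A + B - sqrt ((A - B)^2 + 4 C^2)) / 2 of the characteristic
    polynomial (A - l) (B - l) - C^2. *)
Lemma least_eigenvalue {R : rcfType} (A B C : R) :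
  C != 0 -> 0 <= A -> 0 <= B -> C ^+ 2 <= A * B ->
  exists l, [/\ 0 <= l, l < A, l < B & (A - l) * (B - l) = C ^+ 2].
Proof.
move=> C_neq0 A_ge0 B_ge0 CAB.
have C2_gt0 : 0 < C ^+ 2 by rewrite exprn_even_gt0.
set d := Num.sqrt ((A - B) ^+ 2 + 4 * C ^+ 2).
have d2 : d ^+ 2 = (A - B) ^+ 2 + 4 * C ^+ 2.
  by rewrite sqr_sqrtr // addr_ge0 ?sqr_ge0 // mulr_ge0 // ltW.
have d_ge0 : 0 <= d by exact: sqrtr_ge0.
exists ((A + B - d) / 2); split; [nra|nra|nra|].
have -> : (A - (A + B - d) / 2) * (B - (A + B - d) / 2)
          = (d ^+ 2 - (A - B) ^+ 2) / 4 by field.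
by rewrite d2; field.
Qed.

(** The form minus l is degenerate, hence a multiple of a single square; with
    cos ^+ 2 + sin ^+ 2 = 1 this writes the loss minus l as the sum of two
    squares of loss_excess.  Both vanish only for the line through the mean point
    in the direction of slope cov x y / (var x - l). *)
Lemma D_loss_unique_minimizer {R : realType} {n : nat} (x y : 'rV[R]_n)
    (l : R) :
  (0 < n)%N -> l < var x -> (var x - l) * (var y - l) = cov x y ^+ 2 ->
  let theta := atan (cov x y / (var x - l)) in
  unique_minimizer (@D_domain R) (D_loss x y)
    (theta, mean (x 0) * sin theta - mean (y 0) * cos theta).
Proof.
move=> n_gt0 lA eql theta; set a := var x - l in eql theta *.
have a_gt0 : 0 < a by rewrite subr_gt0.
have loss_excess t c : D_loss x y (t, c) - l =
    (a * sin t - cov x y * cos t) ^+ 2 / a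
    + (mean (x 0) * sin t - mean (y 0) * cos t - c) ^+ 2.
  have -> : (a * sin t - cov x y * cos t) ^+ 2 =
      a * (a * sin t ^+ 2 - 2 * sin t * cos t * cov x y
           + cos t ^+ 2 * (var y - l)).
    transitivity (a * (a * sin t ^+ 2 - 2 * sin t * cos t * cov x y)
      + cov x y ^+ 2 * cos t ^+ 2); first by ring.
    by rewrite -eql; ring.
  rewrite mulrAC divff ?lt0r_neq0 // mul1r D_loss_eq //.
  (* Homogenize: l is l (cos t ^+ 2 + sin t ^+ 2). *)
  by rewrite -[X in _ - X](mulr1 l) -(cos2Dsin2 t) /a; ring.
have cos_gt0 : 0 < cos theta.
  by apply: cos_gt0_pihalf; rewrite atan_gtNpi2 atan_ltpi2.
have root_theta : a * sin theta - cov x y * cos theta = 0.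
  have := atanK (cov x y / a); rewrite -/theta /tan => e.
  rewrite -(divfK (lt0r_neq0 cos_gt0) (sin theta)) e.
  by field; exact: lt0r_neq0.
set c0 := _ - _.
have loss_theta : D_loss x y (theta, c0) = l.
  apply/eqP; rewrite -subr_eq0 loss_excess root_theta subrr.
  by rewrite expr0n mul0r addr0.
have sq_ge0 t : 0 <= (a * sin t - cov x y * cos t) ^+ 2 / a.
  by rewrite divr_ge0 ?sqr_ge0 ?ltW.
have min_theta : minimizer (@D_domain R) (D_loss x y) (theta, c0).
  split=> [|[t c] _]; first by rewrite /D_domain /= atan_gtNpi2 ltW ?atan_ltpi2.
  rewrite loss_theta -subr_ge0 loss_excess.
  by rewrite addr_ge0 ?sqr_ge0.
split=> // -[t c] fit.
have := D_fit_intercept _ _ _ _ n_gt0 fit.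
case: fit => /= tD /(_ _ min_theta.1); rewrite loss_theta => loss_le ec.
have {loss_le} : (a * sin t - cov x y * cos t) ^+ 2 / a = 0.
  apply/eqP; rewrite eq_le sq_ge0 andbT.
  have := loss_excess t c; rewrite -ec subrr expr0n addr0 => <-.
  by rewrite subr_le0.
move/eqP; rewrite mulf_eq0 invr_eq0 (gt_eqF a_gt0) orbF sqrf_eq0 subr_eq0.
move=> /eqP eqt.
(* If cos t = 0 then eqt gives sin t = 0 as well. *)
have cos_neq0 : cos t != 0.
  apply/eqP => cos0; have := cos2Dsin2 t; move: eqt; rewrite cos0 mulr0.
  move/eqP; rewrite mulf_eq0 (gt_eqF a_gt0) /= => /eqP ->.
  by rewrite expr0n addr0 => /esym/eqP; rewrite oner_eq0.
have t_lt : t < pi / 2.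
  rewrite lt_neqAle; case/andP: tD => _ ->; rewrite andbT.
  by apply: contra_neq cos_neq0 => ->; exact: cos_pihalf.
have et : t = theta.
  rewrite /theta -[LHS]tanK ?in_itv /=; last first.
    by rewrite t_lt; case/andP: tD => ->.
  congr atan; rewrite /tan; apply/eqP; rewrite eqr_div ?(gt_eqF a_gt0) //.
  by rewrite mulrC eqt.
by rewrite /c0 -et -ec.
Qed.

Lemma unique_minimizer_eq {R : realType} {T : Type} (D : set T) (f : T -> R)
  (s t : T) : unique_minimizer D f s -> unique_minimizer D f t -> s = t.
Proof. by move=> [min_s _] [_ uniq_t]; exact: uniq_t. Qed.

Lemma D_slopeP {R : realType} {n : nat} (x y : 'rV[R]_n) (l s : R) :
  (0 < n)%N -> l < var x -> (var x - l) * (var y - l) = cov x y ^+ 2 ->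
  D_slope x y s <-> s = cov x y / (var x - l).
Proof.
move=> n_gt0 lA eql.
have /= min0 := D_loss_unique_minimizer _ _ _ n_gt0 lA eql.
split=> [[t [c [min_t _ ->]]]|->].
  by have [-> _] := unique_minimizer_eq _ _ _ _ min_t min0; rewrite atanK.
exists (atan (cov x y / (var x - l))); eexists; split; first exact: min0.
  by rewrite lt_eqF ?atan_ltpi2.
by rewrite atanK.
Qed.

(** Without correlation the loss of a line through the mean point is even in the
    angle, so a unique minimizer with angle t < pi / 2 has - t = t. *)
Lemma D_slope_uncorrelated {R : realType} {n : nat} (x y : 'rV[R]_n) (s : R) :
  (0 < n)%N -> cov x y = 0 -> D_slope x y s -> s = 0.
Proof.
move=> n_gt0 C0 [t [c [[min_t uniq_t] t_neq ->]]].
have ec := D_fit_intercept _ _ _ _ n_gt0 min_t.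
case: min_t => /andP[/= t_gt t_le] min_t.
have t_lt : t < pi / 2 by rewrite lt_neqAle t_neq.
pose c' := mean (x 0) * sin (- t) - mean (y 0) * cos (- t).
have /uniq_t [et _] : minimizer (@D_domain R) (D_loss x y) (- t, c').
  split=> [|p pD]; first by rewrite /D_domain /=; apply/andP; split; lra.
  apply: le_trans (min_t p pD); rewrite !D_loss_eq // -ec C0.
  by rewrite /c' sinN cosN !subrr sqrrN !mulr0.
have -> : t = 0 by lra.
exact: tan0.
Qed.

(** For C != 0 this is the eigenvector construction.  For C = 0 the form is
    diagonal, and the direction of the larger variance is best. *)
Lemma D_fit_exists {R : realType} {n : nat} (x y : 'rV[R]_n) :
  (0 < n)%N -> exists theta c, D_fit x y theta c.
Proof.
move=> n_gt0; have [C0|C_neq0] := eqVneq (cov x y) 0; last first.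
  have [l [_ lA _ eql]] := least_eigenvalue _ _ _ C_neq0
    (var_ge0 x n_gt0) (var_ge0 y n_gt0) (cov_sq_le x y n_gt0).
  have [min_t _] := D_loss_unique_minimizer _ _ _ n_gt0 lA eql.
  by do 2!eexists; exact: min_t.
have pi2_gt0 : 0 < pi / 2 :> R by rewrite divr_gt0 ?pi_gt0.
have [BA|/ltW AB] := leP (var y) (var x).
  exists 0, (- mean (y 0)); split=> [|[t c] _].
    by rewrite /D_domain /= oppr_lt0 pi2_gt0 ltW.
  rewrite !D_loss_eq // C0 sin0 cos0; set sq := (_ - c) ^+ 2.
  have cos2 : cos t ^+ 2 = 1 - sin t ^+ 2 by have := cos2Dsin2 t; lra.
  rewrite -subr_ge0 cos2 (_ : _ - _ = (var x - var y) * sin t ^+ 2 + sq);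
    last by ring.
  by rewrite addr_ge0 ?sqr_ge0 // mulr_ge0 ?sqr_ge0 ?subr_ge0.
exists (pi / 2), (mean (x 0)); split=> [|[t c] _].
  by rewrite /D_domain /= lexx andbT; lra.
rewrite !D_loss_eq // C0 sin_pihalf cos_pihalf; set sq := (_ - c) ^+ 2.
have sin2 : sin t ^+ 2 = 1 - cos t ^+ 2 by have := cos2Dsin2 t; lra.
rewrite -subr_ge0 sin2 (_ : _ - _ = (var y - var x) * cos t ^+ 2 + sq);
  last by ring.
by rewrite addr_ge0 ?sqr_ge0 // mulr_ge0 ?sqr_ge0 ?subr_ge0.
Qed.

Lemma D_line_eq {R : realType} {n : nat} (x y : 'rV[R]_n) (t c : R) :
  (0 < n)%N -> D_fit x y t c ->
  D_line_of t c =
  [set p | (p.1 - mean (x 0)) * sin t = (p.2 - mean (y 0)) * cos t].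
Proof.
move=> n_gt0 /D_fit_intercept -> //.
by apply/seteqP; split=> -[u v]; rewrite /D_line_of /= => e; lra.
Qed.

(** * Comparison of the slopes *)

Lemma Y_slopeP {R : realType} {n : nat} (x y : 'rV[R]_n) (s : R) :
  (0 < n)%N -> var x != 0 -> Y_slope x y s <-> s = cov x y / var x.
Proof.
move=> n_gt0 A_neq0; split=> [[b /Y_fitP [] //]|->].
by eexists; apply/Y_fitP.
Qed.

Lemma X_slopeP {R : realType} {n : nat} (x y : 'rV[R]_n) (s : R) :
  (0 < n)%N -> var y != 0 -> cov x y != 0 ->
  X_slope x y s <-> s = var y / cov x y.
Proof.
move=> n_gt0 B_neq0 C_neq0; split=> [[mu [beta [fit _ ->]]]|->].
  have [-> _] := (Y_fitP y x _ _ n_gt0 B_neq0).1 fit.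
  by rewrite covC div1r invf_div.
exists (cov y x / var y); eexists; split.
- by apply/(Y_fitP y x).
- by rewrite covC mulf_neq0 ?invr_eq0.
- by rewrite covC div1r invf_div.
Qed.

Lemma regression_slopes_uncorrelated {R : realType} {n : nat} (x y : 'rV[R]_n)
    (s : R) :
  (0 < n)%N -> cov x y = 0 -> regression_slopes x y s -> s = 0.
Proof.
move=> n_gt0 C0 [[b fit]|[mu [beta [fit mu_neq0 _]]]|].
- by have [-> _] := (Y_fitP _ _ _ _ n_gt0 fit.1).1 fit; rewrite C0 mul0r.
- have [emu _] := (Y_fitP y x _ _ n_gt0 fit.1).1 fit.
  by move: mu_neq0; rewrite emu covC C0 mul0r eqxx.
- exact: D_slope_uncorrelated.
Qed.

Lemma vars_gt0 {R : realType} {n : nat} (x y : 'rV[R]_n) :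
  (0 < n)%N -> cov x y != 0 -> 0 < var x /\ 0 < var y.
Proof.
move=> n_gt0 C_neq0.
have AB_gt0 : 0 < var x * var y.
  by apply: lt_le_trans (cov_sq_le x y n_gt0); rewrite exprn_even_gt0.
have := var_ge0 x n_gt0; have := var_ge0 y n_gt0 => B_ge0 A_ge0.
rewrite !lt_def B_ge0 A_ge0 !andbT; apply/andP.
by rewrite -negb_or -mulf_eq0 gt_eqF.
Qed.

(** Every slope is cov x y times a positive factor. *)
Lemma regression_slope_sign {R : realType} {n : nat} (x y : 'rV[R]_n) (s : R) :
  (0 < n)%N -> cov x y != 0 -> regression_slopes x y s -> 0 < s * cov x y.
Proof.
move=> n_gt0 C_neq0; have [A_gt0 B_gt0] := vars_gt0 x y n_gt0 C_neq0.
have C2_gt0 : 0 < cov x y * cov x y by rewrite -expr2 exprn_even_gt0.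
have [l [_ lA _ eql]] := least_eigenvalue _ _ _ C_neq0
  (ltW A_gt0) (ltW B_gt0) (cov_sq_le x y n_gt0).
case=> [/Y_slopeP|/X_slopeP|/(D_slopeP _ _ _ _ n_gt0 lA eql)].
- by move=> -> //; rewrite ?gt_eqF // mulrAC divr_gt0.
- by move=> -> //; rewrite ?gt_eqF // divfK.
- by move=> ->; rewrite mulrAC divr_gt0 // subr_gt0.
Qed.

(** |C / A| and |B / C| have geometric mean sqrt (B / A) and ratio
    C^2 / (A B) <= 1, so sqrt (B / A) separates them and equals one of them only
    when the ratio is 1.  The differences of the squares, gapY and gapX, are
    positive multiples of A B - C^2. *)
Lemma slope_bounds {R : rcfType} (A B C : R) :
  0 < A -> 0 < B -> C != 0 -> C ^+ 2 <= A * B ->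
  [/\ `|C / A| <= Num.sqrt (B / A),
      Num.sqrt (B / A) <= `|B / C|,
      `|C / A| = Num.sqrt (B / A) <-> A * B = C ^+ 2 &
      Num.sqrt (B / A) = `|B / C| <-> A * B = C ^+ 2].
Proof.
move=> A_gt0 B_gt0 C_neq0 CAB.
have C2_gt0 : 0 < C ^+ 2 by rewrite exprn_even_gt0.
have A_neq0 := lt0r_neq0 A_gt0.
have BA_ge0 : 0 <= B / A by rewrite divr_ge0 ?ltW.
have gapY : B / A - (C / A) ^+ 2 = (A * B - C ^+ 2) / A ^+ 2 by field.
have gapX : (B / C) ^+ 2 - B / A = (A * B - C ^+ 2) * (B / (A * C ^+ 2)).
  by field; rewrite A_neq0 C_neq0.
have fY_gt0 : 0 < (A ^+ 2)^-1 by rewrite invr_gt0 exprn_gt0.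
have fX_gt0 : 0 < B / (A * C ^+ 2) by rewrite divr_gt0 // mulr_gt0.
rewrite -!(sqrtr_sqr (_ / _)) !ler_sqrt ?sqr_ge0 //.
rewrite -[(_ <= B / A)]subr_ge0 gapY -[(B / A <= _)]subr_ge0 gapX.
have disc0 f : 0 < f -> (A * B - C ^+ 2) * f = 0 <-> A * B = C ^+ 2.
  move=> f_gt0; split=> [/eqP|->]; last by rewrite subrr mul0r.
  by rewrite mulf_eq0 (gt_eqF f_gt0) orbF subr_eq0 => /eqP.
split; [by rewrite pmulr_lge0 ?subr_ge0 | by rewrite pmulr_lge0 ?subr_ge0 | |].
- rewrite -(disc0 _ fY_gt0) -gapY; split=> [/eqP|/eqP].
    by rewrite eqr_sqrt ?sqr_ge0 // => /eqP ->; rewrite subrr.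
  by rewrite subr_eq0 => /eqP ->.
- rewrite -(disc0 _ fX_gt0) -gapX; split=> [/eqP|/eqP].
    by rewrite eqr_sqrt ?sqr_ge0 // => /eqP ->; rewrite subrr.
  by rewrite subr_eq0 => /eqP ->.
Qed.

(** Writing the slope as C / (A - l) compares it with C / A, writing it as
    (B - l) / C compares it with B / C. *)
Lemma D_slope_bounds {R : realType} {n : nat} (x y : 'rV[R]_n) (s : R) :
  (0 < n)%N -> cov x y != 0 -> D_slope x y s ->
  `|cov x y / var x| <= `|s| /\ `|s| <= `|var y / cov x y|.
Proof.
move=> n_gt0 C_neq0; have [A_gt0 B_gt0] := vars_gt0 x y n_gt0 C_neq0.
have [l [l_ge0 lA lB eql]] := least_eigenvalue _ _ _ C_neq0
  (ltW A_gt0) (ltW B_gt0) (cov_sq_le x y n_gt0).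
have a_gt0 : 0 < var x - l by rewrite subr_gt0.
have b_gt0 : 0 < var y - l by rewrite subr_gt0.
move=> /(D_slopeP _ _ _ _ n_gt0 lA eql) es; split.
  rewrite es !normrM !normfV (gtr0_norm A_gt0) (gtr0_norm a_gt0).
  by rewrite ler_wpM2l // lef_pV2 ?posrE // gerBl.
have -> : s = (var y - l) / cov x y.
  rewrite es; apply/eqP; rewrite eqr_div ?(lt0r_neq0 a_gt0) //.
  by rewrite -expr2 -eql mulrC.
rewrite !normrM (gtr0_norm B_gt0) (gtr0_norm b_gt0).
by rewrite ler_wpM2r // gerBl.
Qed.

Theorem corollary3p3 (R : realType) (n : nat) (hn : (2 <= n)%N)
    (x y : 'rV[R]_n) :
  let xbar := mean (x 0) in
  let ybar := mean (y 0) in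
  let m := cov x y / var x in
  let mX := var y / cov x y in
  (* (a) *)
  ((var x != 0 ->
      is_Y_line x y
        [set p : R * R | (p.2 - ybar) * var x = (p.1 - xbar) * cov x y]) /\
   (var y != 0 ->
      is_X_line x y
        [set p : R * R | (p.1 - xbar) * var y = (p.2 - ybar) * cov x y]) /\
   (exists theta c, D_fit x y theta c) /\
   (forall theta c, D_fit x y theta c ->
      D_line_of theta c =
        [set p : R * R | (p.1 - xbar) * sin theta = (p.2 - ybar) * cos theta]))
  /\
  (* (b) *)
  ((forall L, is_Y_line x y L -> L (xbar, ybar)) /\
   (forall L, is_X_line x y L -> L (xbar, ybar)) /\
   (forall L, is_D_line x y L -> L (xbar, ybar)) /\
   (forall LY LX LD, is_Y_line x y LY -> is_X_line x y LX ->
      is_D_line x y LD -> (LY `&` LX `&` LD) (xbar, ybar)))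
  /\
  (* (c) *)
  (var x * var y >= cov x y ^+ 2 /\
   (var x * var y = cov x y ^+ 2 <-> collinear x y))
  /\
  (* (d) *)
  same_sign (regression_slopes x y)
  /\
  (* (e) *)
  (cov x y != 0 ->
     Y_slope x y m /\ X_slope x y mX /\
     `|m| <= Num.sqrt (var y / var x) /\
     Num.sqrt (var y / var x) <= `|mX| /\
     (`|m| = Num.sqrt (var y / var x) <-> collinear x y) /\
     (Num.sqrt (var y / var x) = `|mX| <-> collinear x y))
  /\
  (* (f) *)
  (cov x y != 0 ->
     (exists t, D_slope x y t) /\
     (forall t, D_slope x y t ->
        (var x >= var y -> `|m| <= `|t| /\ `|t| <= `|mX|) /\
        (var x < var y ->
           2 * cov x y ^+ 2 >= var x * `|var x - var y| ->
           `|m| <= `|t| /\ `|t| <= `|mX|))).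
Proof.
have n_gt0 : (0 < n)%N by exact: leq_trans hn.
move=> xbar ybar m mX.
have Y_line L : is_Y_line x y L ->
    L = [set p | (p.2 - ybar) * var x = (p.1 - xbar) * cov x y].
  by case=> a [b [fit ->]]; exact: Y_line_eq.
have X_line L : is_X_line x y L ->
    L = [set p | (p.1 - xbar) * var y = (p.2 - ybar) * cov x y].
  by case=> a [b [fit ->]]; exact: X_line_eq.
have Y_mean L : is_Y_line x y L -> L (xbar, ybar).
  by move=> /Y_line -> /=; rewrite !subrr !mul0r.
have X_mean L : is_X_line x y L -> L (xbar, ybar).
  by move=> /X_line -> /=; rewrite !subrr !mul0r.
have D_mean L : is_D_line x y L -> L (xbar, ybar).
  by case=> t [c [/D_line_eq -> // ->]] /=; rewrite !subrr !mul0r.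
split; [|split; [|split; [|split; [|split]]]].
- split; [|split; [|split]].
  + move=> A_neq0.
    have /Y_slopeP [] // := erefl m => b fit.
    by exists m, b; split=> //; rewrite (Y_line_eq x y m b).
  + move=> B_neq0.
    have /(Y_slopeP y x) [] // := erefl (cov y x / var y) => b fit.
    by exists (cov y x / var y), b; split=> //; rewrite (X_line_eq x y _ b).
  + exact: D_fit_exists.
  + by move=> t c; exact: D_line_eq.
- split=> //; split=> //; split=> // LY LX LD /Y_mean ? /X_mean ? /D_mean ?.
  by [].
- split; [exact: cov_sq_le | exact: eq_cov_sq_collinear].
- have [C_lt0|C_gt0|C0] := ltgtP (cov x y) 0.
  + constructor 2 => s /regression_slope_sign.
    rewrite lt_eqF // => /(_ n_gt0 isT).
    by rewrite nmulr_lgt0.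
  + constructor 1 => s /regression_slope_sign.
    rewrite gt_eqF // => /(_ n_gt0 isT).
    by rewrite pmulr_lgt0.
  + by constructor 3 => s; exact: regression_slopes_uncorrelated.
- move=> C_neq0; have [A_gt0 B_gt0] := vars_gt0 x y n_gt0 C_neq0.
  have [leY leX eqY eqX] :=
    slope_bounds _ _ _ A_gt0 B_gt0 C_neq0 (cov_sq_le x y n_gt0).
  have collP := eq_cov_sq_collinear x y n_gt0.
  split; first by apply/Y_slopeP; rewrite ?(lt0r_neq0 A_gt0).
  split; first by apply/X_slopeP; rewrite ?(lt0r_neq0 B_gt0).
  do 2!split=> //.
  by split; [exact: iff_trans eqY collP | exact: iff_trans eqX collP].
- move=> C_neq0; have [A_gt0 B_gt0] := vars_gt0 x y n_gt0 C_neq0.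
  have [l [_ lA _ eql]] := least_eigenvalue _ _ _ C_neq0
    (ltW A_gt0) (ltW B_gt0) (cov_sq_le x y n_gt0).
  split.
    by exists (cov x y / (var x - l)); exact/(D_slopeP _ _ l _ n_gt0 lA eql).
  by move=> t /D_slope_bounds bounds; split=> *; exact: bounds.
Qed.
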